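(* Let $\mathcal{P}$ be a hereditary graph property and let $G$ be a graph with vertices $v_1,\dots,v_n$. Let $K=|\mathcal{P}^m(G)|$. Then the algorithm GenHered (described in the context) applied to $G$ returns exactly $\mathcal{P}^m(G)$, and it runs in time $O\big(n^2\, s_{\mathcal{P}}(n)\, K\, r_{\mathcal{P}}(n,K)\big)$.
   Context: A graph is a triple $G=(V,E,r)$ with $V$ a finite set of vertices, $E\subseteq V\times V$ a set of (directed) edges, and a root $r\in V\cup\{\bot\}$. $H$ is an induced subgraph of $G$, written $H\subseteq_{\mathrm{IS}} G$, if $H$ is obtained from $G$ by deleting some vertices (and the edges incident to them), and the root of $H$ equals the root of $G$ if that root is still a vertex of $H$, and is $\bot$ otherwise; $H\subset_{\mathrm{IS}} G$ means $H\subseteq_{\mathrm{IS}} G$ and $H\neq G$. For $U\subseteq V$, $G[U]$ is the induced subgraph of $G$ with vertex set $U$, and $G[H,v]$ abbreviates $G[V(H)\cup\{v\}]$; $G-v$ is $G[V\setminus\{v\}]$. A graph property is a nonempty (possibly infinite) set $\mathcal{P}$ of graphs; it is assumed that membership $G\in\mathcal{P}$ can be tested in polynomial time, and $s_{\mathcal{P}}(n)$ denotes the time needed to test membership for a graph with $n$ vertices. $\mathcal{P}$ is hereditary if whenever $G\in\mathcal{P}$, every induced subgraph of $G$ is in $\mathcal{P}$. A $\mathcal{P}$-subgraph of $G$ is an $H\subseteq_{\mathrm{IS}}G$ with $H\in\mathcal{P}$; it is maximal if there is no $\mathcal{P}$-subgraph $H'$ of $G$ with $H\subset_{\mathrm{IS}}H'$;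 $\mathcal{P}^m(G)$ is the set of maximal $\mathcal{P}$-subgraphs of $G$. $G$ almost satisfies $\mathcal{P}$ if $G-v\in\mathcal{P}$ for some vertex $v$. Fix a procedure $\mathrm{R}$ which, given a graph $H$ that almost satisfies $\mathcal{P}$, returns $\mathcal{P}^m(H)$; $r_{\mathcal{P}}(n,K)$ denotes its running time on an input with $n$ vertices whose output consists of $K$ graphs. Algorithm GenHered on input $G$ with vertices $v_1,\dots,v_n$: initialize a collection $\mathcal{G}=\{O_0\}$, where $O_0$ is the graph with no vertices and no edges. For $i=1,\dots,n$: let $\mathcal{H}$ be a copy of the current $\mathcal{G}$; for each $H\in\mathcal{H}$, remove $H$ from $\mathcal{G}$, and then for each $H'\in\mathrm{R}(G[H,v_i])$, if $H'$ is a maximal $\mathcal{P}$-subgraph of $G[\{v_1,\dots,v_i\}]$ then add $H'$ to $\mathcal{G}$. After the loop, return $\mathcal{G}$.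
   Formalization: The time bounds s_P(n) and r_P(n,K) are assumed nondecreasing in n and K, since GenHered tests smaller induced subgraphs and the bound fails otherwise; a test takes at least one step, outputting K graphs at least K steps, and the time bound is for n ≥ 1. *)

(* Defs.v *)
From HB Require Import structures.
From mathcomp Require Import all_boot finmap.
From mathcomp Require Import boolp.

Set Implicit Arguments.
Unset Strict Implicit.
Unset Printing Implicit Defensive.

Local Open Scope fset_scope.

(* Graphs (V, E, r) with vertices drawn from a universe T of vertex names;
   r = None stands for the root "bottom". *)

Definition graph_wf (T : choiceType)
    (x : {fset T} * {fset T * T} * option T) : bool :=
  all (fun e => (e.1 \in x.1.1) && (e.2 \in x.1.1)) (enum_fset x.1.2)
  && (if x.2 is Some r then r \in x.1.1 else true).

Record graph (T : choiceType) := Graph {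
  gdata : {fset T} * {fset T * T} * option T;
  _ : graph_wf gdata }.

HB.instance Definition _ (T : choiceType) := [isSub for @gdata T].
HB.instance Definition _ (T : choiceType) := [Choice of graph T by <:].

Definition vertices (T : choiceType) (G : graph T) : {fset T} := (gdata G).1.1.
Definition edges (T : choiceType) (G : graph T) : {fset T * T} := (gdata G).1.2.
Definition groot (T : choiceType) (G : graph T) : option T := (gdata G).2.

Lemma graph0_wf (T : choiceType) :
  graph_wf (fset0 : {fset T}, fset0 : {fset T * T}, None : option T).
Proof. by apply/andP; split => //; apply/allP => e; rewrite inE. Qed.

Definition graph0 (T : choiceType) : graph T := Graph (graph0_wf T).

Definition induced_data (T : choiceType) (G : graph T) (U : {fset T}) :=
  (vertices G `&` U,
   [fset e in edges G | (e.1 \in U) && (e.2 \in U)],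
   if groot G is Some r then if r \in U then Some r else None else None).

Lemma induced_wf (T : choiceType) (G : graph T) (U : {fset T}) :
  graph_wf (induced_data G U).
Proof.
case: G => [[[V E] r] wf]; have /andP[/= /allP EV rV] := wf.
rewrite /graph_wf /induced_data /vertices /edges /groot /=; apply/andP; split.
  apply/allP => e; rewrite !inE /= => /andP[eE /andP[e1 e2]].
  by have /andP[-> ->] := EV e eE; rewrite e1 e2.
by case: r {wf} rV => // r rV; case: ifP => // rU; rewrite inE rV.
Qed.

(* G[U] *)
Definition induced (T : choiceType) (G : graph T) (U : {fset T}) : graph T :=
  Graph (induced_wf G U).

(* G[H, v] *)
Definition induced_add (T : choiceType) (G H : graph T) (v : T) : graph T :=
  induced G (v |` vertices H).

(* G - v *)
Definition del_vertex (T : choiceType) (G : graph T) (v : T) : graph T :=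
  induced G (vertices G `\ v).

Definition induced_subgraph (T : choiceType) (H G : graph T) : Prop :=
  exists2 U : {fset T}, U `<=` vertices G & H = induced G U.

Definition proper_induced_subgraph (T : choiceType) (H G : graph T) : Prop :=
  induced_subgraph H G /\ H <> G.

Definition graph_property (T : choiceType) (P : graph T -> Prop) : Prop :=
  exists G, P G.

Definition hereditary (T : choiceType) (P : graph T -> Prop) : Prop :=
  forall G H, P G -> induced_subgraph H G -> P H.

Definition P_subgraph (T : choiceType) (P : graph T -> Prop) (G H : graph T) :
    Prop :=
  induced_subgraph H G /\ P H.

Definition maximal_P_subgraph (T : choiceType) (P : graph T -> Prop)
    (G H : graph T) : Prop :=
  P_subgraph P G H /\
  ~ (exists H', P_subgraph P G H' /\ proper_induced_subgraph H H').

(* P^m(G); the fpowerset only serves to bound the comprehension. *)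
Definition max_P_subgraphs (T : choiceType) (P : graph T -> Prop)
    (G : graph T) : {fset graph T} :=
  [fset H in [fset induced G U | U in fpowerset (vertices G)]
     | `[< maximal_P_subgraph P G H >]].

Lemma in_max_P_subgraphs (T : choiceType) (P : graph T -> Prop)
    (G H : graph T) :
  H \in max_P_subgraphs P G <-> maximal_P_subgraph P G H.
Proof.
rewrite !inE /=; split=> [/andP[_ /asboolP]//|maxH].
apply/andP; split; last exact/asboolP.
have [[[U UG ->] _] _] := maxH.
by apply: in_imfset; rewrite /= fpowersetE.
Qed.

Definition almost_satisfies (T : choiceType) (P : graph T -> Prop)
    (G : graph T) : Prop :=
  exists2 v, v \in vertices G & P (del_vertex G v).

(* Computations instrumented with the number of elementary steps they take. *)

Record timed (A : Type) := Timed { result : A; time : nat }.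

Definition ret (A : Type) (a : A) : timed A := Timed a 0.

Definition bind (A B : Type) (m : timed A) (f : A -> timed B) : timed B :=
  Timed (result (f (result m))) (time m + time (f (result m))).

Definition tick (k : nat) : timed unit := Timed tt k.

Declare Scope timed_scope.
Delimit Scope timed_scope with timed.
Notation "x <-- m ;; k" := (bind m (fun x => k))
  (at level 100, m at next level, right associativity) : timed_scope.
Notation "m ;;; k" := (bind m (fun _ => k))
  (at level 100, right associativity) : timed_scope.

Local Open Scope timed_scope.

Fixpoint for_each (A S : Type) (l : seq A) (st : S) (body : A -> S -> timed S) :
    timed S :=
  if l is a :: l' then
    tick 1 ;;; st' <-- body a st ;; for_each l' st' body
  else ret st.

(* Cost model. The input graph is stored once, and an induced subgraph of it
   is represented by the 0/1 vector of its vertices, indexed by v_1, ..., v_n.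
   Hence reading or writing one entry is one step, copying a subgraph takes
   n + 1 steps, and a collection of subgraphs is a binary trie of such
   vectors: insertion and removal take n + 1 steps, and listing a collection
   of k subgraphs takes (n + 1) * (k + 1) steps. *)

Definition coll_copy (T : choiceType) (n : nat) (C : {fset graph T}) :
    timed (seq (graph T)) :=
  tick (n.+1 * #|` C|.+1) ;;; ret (enum_fset C).

Definition coll_remove (T : choiceType) (n : nat) (H : graph T)
    (C : {fset graph T}) : timed {fset graph T} :=
  tick n.+1 ;;; ret (C `\ H).

Definition coll_add (T : choiceType) (n : nat) (H : graph T)
    (C : {fset graph T}) : timed {fset graph T} :=
  tick n.+1 ;;; ret (H |` C).

(* M decides membership in P, in at least one step and at most s n steps on
   graphs with n vertices. *)
Record membership_test (T : choiceType) (P : graph T -> Prop)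
    (M : graph T -> timed bool) (s : nat -> nat) : Prop := {
  test_correct : forall G, result (M G) <-> P G;
  test_pos : forall G, 0 < time (M G);
  test_time : forall G, time (M G) <= s #|` vertices G|;
  test_mono : forall n n', n <= n' -> s n <= s n' }.

Definition polynomially_bounded (s : nat -> nat) : Prop :=
  exists c d, forall n, s n <= c * n ^ d + c.

(* R lists P^m(H), without repetition, for every H that almost satisfies P;
   nothing is assumed on other inputs. Producing K graphs takes at least K
   steps, and at most r n K steps if H has n vertices. *)
Record restricted_procedure (T : choiceType) (P : graph T -> Prop)
    (R : graph T -> timed (seq (graph T))) (r : nat -> nat -> nat) : Prop := {
  proc_uniq : forall H, almost_satisfies P H -> uniq (result (R H));
  proc_correct : forall H, almost_satisfies P H ->
    result (R H) =i max_P_subgraphs P H;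
  proc_output : forall H, almost_satisfies P H ->
    size (result (R H)) <= time (R H);
  proc_time : forall H, almost_satisfies P H ->
    time (R H) <= r #|` vertices H| #|` max_P_subgraphs P H|;
  proc_mono : forall n n' K K', n <= n' -> K <= K' -> r n K <= r n' K' }.

(* Is no G[H, v], with v in us outside H, in P? For each such v, the entry of v
   in the vector of H is set, M is run, and the entry is cleared again. *)
Fixpoint no_extension (T : choiceType) (M : graph T -> timed bool)
    (G : graph T) (us : seq T) (H : graph T) : timed bool :=
  if us is v :: us' then
    tick 1 ;;;
    if v \in vertices H then no_extension M G us' H
    else
      tick 2 ;;;
      b <-- M (induced_add G H v) ;;
      if b then ret false else no_extension M G us' H
  else ret true.

(* Test that H is a maximal P-subgraph of G[us], for a hereditary P. *)
Definition maximality_test (T : choiceType) (M : graph T -> timed bool)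
    (n : nat) (G : graph T) (us : seq T) (H : graph T) : timed bool :=
  tick n.+1 ;;;
  b <-- M H ;;
  if b then no_extension M G us H else ret false.

(* The i-th iteration, with us = [:: v_1; ...; v_i] and v = v_i. *)
Definition gen_hered_step (T : choiceType) (M : graph T -> timed bool)
    (R : graph T -> timed (seq (graph T))) (n : nat) (G : graph T)
    (us : seq T) (v : T) (C : {fset graph T}) : timed {fset graph T} :=
  Hs <-- coll_copy n C ;;
  for_each Hs C (fun H C1 =>
    C2 <-- coll_remove n H C1 ;;
    tick n.+1 ;;;
    Hs' <-- R (induced_add G H v) ;;
    for_each Hs' C2 (fun H' C3 =>
      b <-- maximality_test M n G us H' ;;
      if b then coll_add n H' C3 else ret C3)).

Fixpoint gen_hered_loop (T : choiceType) (M : graph T -> timed bool)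
    (R : graph T -> timed (seq (graph T))) (n : nat) (G : graph T)
    (us vs : seq T) (C : {fset graph T}) : timed {fset graph T} :=
  if vs is v :: vs' then
    tick 1 ;;;
    C' <-- gen_hered_step M R n G (rcons us v) v C ;;
    gen_hered_loop M R n G (rcons us v) vs' C'
  else ret C.

Definition gen_hered (T : choiceType) (M : graph T -> timed bool)
    (R : graph T -> timed (seq (graph T))) (G : graph T) (vs : seq T) :
    timed {fset graph T} :=
  tick 1 ;;;
  gen_hered_loop M R (size vs) G [::] vs [fset graph0 T].

Definition vertex_enumeration (T : choiceType) (G : graph T) (vs : seq T) :
    Prop :=
  uniq vs /\ vs =i vertices G.

(* Main.v *)
Require Import Defs.
From mathcomp Require Import all_boot finmap.
From mathcomp Require Import boolp zify.

Set Implicit Arguments.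
Unset Strict Implicit.
Unset Printing Implicit Defensive.

(** The collection after [i] rounds is [P^m(G_i)], where [G_i = G[v_1, ..., v_i]].
    A maximal [P]-subgraph [H'] of [G_(i+1)] loses at most [v_(i+1)] when cut down
    to [G_i]; by heredity the rest extends to some [H] in [P^m(G_i)], so [H'] is
    found by [R] inside [G[H, v_(i+1)]].  For the running time, the number of maximal
    [P]-subgraphs can only grow when passing from an induced subgraph [G1] of [G] to
    [G]: each member of [P^m(G1)] is the trace on [G1] of any of its maximal
    extensions in [G].  Hence neither the intermediate collections nor the outputs
    of [R] ever have more than [K] members. *)

(** Here [S] stands for [s n] and [Q] for [r n K]. Each of the [n] rounds pays for listing the
    collection, then for up to [K] removals, constructions of [G[H, v]] and calls to [R], each
    followed by up to [Q] tests and insertions; the successors are the loop ticks. *)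
Lemma gen_hered_cost_le (n K S Q : nat) :
    0 < n -> 0 < K -> 0 < S -> 0 < Q ->
  1 + n * (n.+1 * K.+1 +
    K * (2 * n.+1 + Q + Q * (2 * n.+1 + S + n * (S + 3)).+1).+1).+1 <=
  40 * (n ^ 2 * S * K * Q).
Proof.
(* [X] bounds one round up to a constant: by positivity, every monomial in the cost of a round is a
   divisor of [X], hence at most [X]. *)
move=> n0 K0 S0 Q0; pose X := n * S * K * Q.
have le a b : 0 < a -> a * b = X -> b <= X by move=> a0 <-; rewrite leq_pmull.
have nX : n <= X by apply: (le (S * K * Q)); rewrite ?muln_gt0 ?S0 ?K0 // /X; lia.
have KX : K <= X by apply: (le (n * S * Q)); rewrite ?muln_gt0 ?n0 ?S0 // /X; lia.
have nKX : n * K <= X by apply: (le (S * Q)); rewrite ?muln_gt0 ?S0 // /X; lia.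
have KQX : K * Q <= X by apply: (le (n * S)); rewrite ?muln_gt0 ?n0 // /X; lia.
have nKQX : n * K * Q <= X by apply: (le S) => //; rewrite /X; lia.
have SKQX : S * K * Q <= X by apply: (le n) => //; rewrite /X; lia.
have -> : n ^ 2 * S * K * Q = n * X by rewrite /X -mulnn; lia.
(* Expanding gives monomials whose coefficients add up to exactly 20. The ticks then give 1 + n +
   20nX, which is at most 22nX, well within 40nX. *)
have : n.+1 * K.+1 +
    K * (2 * n.+1 + Q + Q * (2 * n.+1 + S + n * (S + 3)).+1).+1 <= 20 * X.
  by rewrite /X in nX KX nKX KQX nKQX SKQX *; lia.
set B := (_ + K * _) => BX; have := leq_mul (leqnn n) BX; nia.
Qed.

Local Open Scope fset_scope.

(** * Calculus of induced subgraphs *)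

Section InducedSubgraphs.
Variable T : choiceType.
Implicit Types (G H : graph T) (U W : {fset T}).

Lemma vertices_induced G U : vertices (induced G U) = vertices G `&` U.
Proof. by []. Qed.

Lemma edges_in_vertices G e :
  e \in edges G -> (e.1 \in vertices G) && (e.2 \in vertices G).
Proof. by case: G => [[[V E] r] wf]; case/andP: (wf) => /allP EV _ /EV. Qed.

Lemma groot_in_vertices G r : groot G = Some r -> r \in vertices G.
Proof.
case: G => [[[V E] q] wf]; case/andP: (wf) => _ /= rV.
by rewrite /groot /= => qE; rewrite qE in rV.
Qed.

Lemma induced_induced G U W : induced (induced G U) W = induced G (U `&` W).
Proof.
apply: val_inj; congr (_, _, _) => /=.
- by rewrite /vertices /= fsetIA.
- apply/fsetP => e; rewrite !inE /=; do 5!case: (_ \in _) => //=.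
- rewrite {1}/groot /=; case: (groot G) => // r; rewrite inE.
  by case: ifP.
Qed.

(** Well-formedness enters here: the edges and the root lie on vertices of [G], so nothing is
    discarded. *)
Lemma induced_all G U : vertices G `<=` U -> induced G U = G.
Proof.
move=> /fsubsetP sub; apply: val_inj => /=.
rewrite /induced_data -[RHS]/(val G).
have -> : val G = (vertices G, edges G, groot G) by case: G sub => [[[V E] r] wf].
congr (_, _, _).
- by apply/fsetP => x; rewrite inE andb_idr // => /sub.
- apply/fsetP => e; rewrite !inE /= andb_idr // => /edges_in_vertices/andP[? ?].
  by rewrite !sub.
- by case E: (groot G) => [r|] //; rewrite sub //; apply: groot_in_vertices.
Qed.

Lemma induced_subgraph_induced G U : induced_subgraph (induced G U) G.
Proof.
exists (vertices G `&` U); first exact: fsubsetIl.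
by rewrite -induced_induced (induced_all (fsubset_refl _)).
Qed.

Lemma induced_subgraph_vertices H G :
  induced_subgraph H G -> vertices H `<=` vertices G.
Proof. by move=> [U _ ->]; rewrite vertices_induced fsubsetIl. Qed.

(** Choosing the vertex set as canonical witness reduces comparisons of induced subgraphs of a
    common graph to comparisons of vertex sets. *)
Lemma induced_subgraphE H G : induced_subgraph H G -> H = induced G (vertices H).
Proof.
move=> [U UG ->]; rewrite vertices_induced -induced_induced.
by rewrite (induced_all (fsubset_refl _)).
Qed.

Lemma induced_subgraph_trans G2 G1 G3 :
  induced_subgraph G1 G2 -> induced_subgraph G2 G3 -> induced_subgraph G1 G3.
Proof.
move=> /induced_subgraphE -> /induced_subgraphE ->.
by rewrite induced_induced; apply: induced_subgraph_induced.
Qed.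

Lemma induced_subgraph_sub H1 H2 G :
    induced_subgraph H1 G -> induced_subgraph H2 G ->
  vertices H1 `<=` vertices H2 -> induced_subgraph H1 H2.
Proof.
move=> /induced_subgraphE E1 /induced_subgraphE E2 sub.
exists (vertices H1) => //; rewrite [in RHS]E2 induced_induced.
by rewrite (fsetIidPr sub).
Qed.

Lemma induced_subgraph_inj H1 H2 G :
    induced_subgraph H1 G -> induced_subgraph H2 G ->
  vertices H1 = vertices H2 -> H1 = H2.
Proof. by move=> /induced_subgraphE E1 /induced_subgraphE E2 E; rewrite E1 E -E2. Qed.

Lemma induced_add_subgraph G H v : induced_subgraph (induced_add G H v) G.
Proof. exact: induced_subgraph_induced. Qed.

Lemma vertices_induced_add G H v :
    induced_subgraph H G -> v \in vertices G ->
  vertices (induced_add G H v) = v |` vertices H.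
Proof.
move=> /induced_subgraph_vertices sub vG.
by rewrite vertices_induced; apply/fsetIidPr; rewrite fsubUset fsub1set vG.
Qed.

Lemma induced_subgraph_add G H v :
    induced_subgraph H G -> v \in vertices G ->
  induced_subgraph H (induced_add G H v).
Proof.
move=> HG vG; apply: (induced_subgraph_sub HG (induced_add_subgraph _ _ _)).
by rewrite vertices_induced_add // fsubsetUr.
Qed.

Lemma induced_fset0 G : induced G fset0 = graph0 T.
Proof.
apply: val_inj; congr (_, _, _) => /=.
- by rewrite fsetI0.
- by apply/fsetP => e; rewrite !inE /= andbF.
- by case: (groot G).
Qed.

Lemma graph0_subgraph G : induced_subgraph (graph0 T) G.
Proof. by rewrite -(induced_fset0 G); apply: induced_subgraph_induced. Qed.

End InducedSubgraphs.

(** * Maximal [P]-subgraphs under restriction and extension *)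

Section MaximalSubgraphs.
Variables (T : choiceType) (P : graph T -> Prop).
Hypotheses (P_property : graph_property P) (P_hereditary : hereditary P).
Implicit Types (G H : graph T) (U : {fset T}).

Lemma graph0_in_property : P (graph0 T).
Proof. by have [G PG] := P_property; apply: P_hereditary PG (graph0_subgraph G). Qed.

Lemma maximal_P_subgraphP G H :
  maximal_P_subgraph P G H <->
  P_subgraph P G H /\
  forall H', P_subgraph P G H' -> vertices H `<=` vertices H' -> H' = H.
Proof.
split=> -[PH maxH]; split=> //.
  move=> H' PH' sub; apply: contrapT => neq; apply: maxH; exists H'; split=> //.
  case: PH PH' => HG _ [H'G _]; split; first exact: (induced_subgraph_sub HG H'G).
  by move=> E; apply: neq.
move=> [H' [PH' [HH' neq]]]; apply: neq.
by rewrite (maxH H') // induced_subgraph_vertices.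
Qed.

(** Induction on the number of vertices of [G] missing from [H]: a non-maximal [H] lies in a
    [P]-subgraph with strictly more vertices. *)
Lemma maximal_P_subgraph_extend G H :
    P_subgraph P G H ->
  exists2 H', maximal_P_subgraph P G H' & vertices H `<=` vertices H'.
Proof.
have [k] := ubnP (#|` vertices G| - #|` vertices H|).
elim: k H => // k IHk H ltk PH.
have [maxH|nmaxH] := pselect (maximal_P_subgraph P G H); first by exists H.
have [H' [PH' [HH' neq]]] :
    exists H', P_subgraph P G H' /\ proper_induced_subgraph H H'.
  by apply: contrapT => noext; apply: nmaxH.
have sub := induced_subgraph_vertices HH'.
have lt : #|` vertices H| < #|` vertices H'|.
  apply: fproper_ltn_card; rewrite fproperEneq sub andbT; apply/eqP => E.
  by apply: neq; case: PH PH' => HG _ [H'G _]; apply: (induced_subgraph_inj HG H'G E).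
have le := fsubset_leq_card (induced_subgraph_vertices (proj1 PH')).
have [|//|H2 maxH2 sub2] := IHk H'; first by lia.
by exists H2 => //; apply: fsubset_trans sub sub2.
Qed.

(** Every competitor of [H] inside [G1] is already a competitor inside [G2]. *)
Lemma maximal_P_subgraph_sub G1 G2 H :
    induced_subgraph G1 G2 -> induced_subgraph H G1 ->
  maximal_P_subgraph P G2 H -> maximal_P_subgraph P G1 H.
Proof.
move=> G12 HG1 /maximal_P_subgraphP[[_ PH] maxH].
apply/maximal_P_subgraphP; split=> // H' [H'G1 PH'].
by apply: maxH; split=> //; apply: (induced_subgraph_trans H'G1 G12).
Qed.

(** By heredity the trace of [H'] on [G1] is a [P]-subgraph of [G1]; it contains [H], which is
    maximal there. *)
Lemma maximal_P_subgraph_trace G1 G2 H H' :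
    induced_subgraph G1 G2 -> maximal_P_subgraph P G1 H ->
    P_subgraph P G2 H' -> vertices H `<=` vertices H' ->
  induced H' (vertices G1) = H.
Proof.
move=> G12 /maximal_P_subgraphP[[HG1 PH] maxH] [H'G2 PH'] sub.
have H'I := induced_subgraph_induced H' (vertices G1).
apply: maxH; first split.
- apply: (induced_subgraph_sub _ G12); last by rewrite vertices_induced fsubsetIr.
  exact: (induced_subgraph_trans H'I H'G2).
- exact: P_hereditary H'I.
- by rewrite vertices_induced fsubsetI sub induced_subgraph_vertices.
Qed.

(** The trace of a maximal [P]-subgraph of [G2] may fail to be maximal in [G1]; it is enough that
    the image of the trace map contains all of [P^m(G1)]. *)
Lemma card_max_P_subgraphs_mono G1 G2 :
  induced_subgraph G1 G2 ->
  #|` max_P_subgraphs P G1| <= #|` max_P_subgraphs P G2|.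
Proof.
move=> G12; pose f H := induced H (vertices G1).
have le : #|` [fset f H | H in max_P_subgraphs P G2]| <= #|` max_P_subgraphs P G2|.
  exact: leq_imfset_card.
apply: leq_trans le; apply/fsubset_leq_card/fsubsetP => H /in_max_P_subgraphs maxH.
have [[HG1 PH] _] := maxH.
have PH2 : P_subgraph P G2 H by split=> //; apply: (induced_subgraph_trans HG1 G12).
have [H' maxH' sub] := maximal_P_subgraph_extend PH2.
apply/imfsetP; exists H'; first exact/in_max_P_subgraphs.
by rewrite /f (maximal_P_subgraph_trace G12 maxH) //; case: maxH'.
Qed.

Lemma card_max_P_subgraphs_gt0 G : 0 < #|` max_P_subgraphs P G|.
Proof.
have [|H maxH _] := @maximal_P_subgraph_extend G (graph0 T).
  by split; [apply: graph0_subgraph | apply: graph0_in_property].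
by rewrite cardfs_gt0; apply/fset0Pn; exists H; apply/in_max_P_subgraphs.
Qed.

(** The loop invariant before the first round. *)
Lemma max_P_subgraphs_induced0 G :
  max_P_subgraphs P (induced G fset0) = [fset graph0 T].
Proof.
apply/fsetP => H; rewrite induced_fset0 in_fset1; apply/idP/eqP => [|->].
  move=> /in_max_P_subgraphs[[HG _] _].
  apply: (induced_subgraph_inj HG (graph0_subgraph _)).
  by apply/eqP; rewrite -fsubset0 (induced_subgraph_vertices HG).
apply/in_max_P_subgraphs/maximal_P_subgraphP; split.
  by split; [apply: graph0_subgraph | apply: graph0_in_property].
move=> H' [H'G _] _; apply: (induced_subgraph_inj H'G (graph0_subgraph _)).
by apply/eqP; rewrite -fsubset0 (induced_subgraph_vertices H'G).
Qed.

(** Deleting [v] gives back [H]. This ensures that [R] is only called where its specification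
    applies. *)
Lemma almost_satisfies_add G H v :
    P_subgraph P G H -> v \in vertices G -> v \notin vertices H ->
  almost_satisfies P (induced_add G H v).
Proof.
move=> [HG PH] vG vH; exists v; first by rewrite vertices_induced_add // fset1U1.
rewrite /del_vertex vertices_induced_add // fsetU1K // induced_induced.
rewrite (_ : _ `&` _ = vertices H) -?(induced_subgraphE HG) //.
exact/fsetIidPr/fsubsetUr.
Qed.

(** Take for [H] a maximal extension of the trace of [H'] on [U]. Then [H'] lies in [G[H, v]],
    having at most [v] outside [U], and it stays maximal there because [G[H, v]] is itself induced
    in the larger graph. *)
Lemma maximal_P_subgraph_step G U v H' :
    v \in vertices G -> v \notin U ->
  maximal_P_subgraph P (induced G (v |` U)) H' ->
  exists2 H, maximal_P_subgraph P (induced G U) H &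
    maximal_P_subgraph P (induced_add G H v) H'.
Proof.
move=> vG vU maxH'; have [[H'G PH'] _] := maxH'.
pose GU := induced G U; pose GvU := induced G (v |` U).
have GUG : induced_subgraph GU G by apply: induced_subgraph_induced.
have GvUG : induced_subgraph GvU G by apply: induced_subgraph_induced.
have H'sub := induced_subgraph_vertices H'G.
have H'GG := induced_subgraph_trans H'G GvUG.
have H'I := induced_subgraph_induced H' U.
have P0 : P_subgraph P GU (induced H' U).
  split; last exact: P_hereditary H'I.
  apply: (induced_subgraph_sub (induced_subgraph_trans H'I H'GG) GUG).
  by rewrite !vertices_induced fsetSI // induced_subgraph_vertices.
have [H maxH sub] := maximal_P_subgraph_extend P0.
have [[HGU PH] _] := maxH.
have HG := induced_subgraph_trans HGU GUG.
have addG := induced_add_subgraph G H v.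
exists H => //; apply: (maximal_P_subgraph_sub _ _ maxH').
  apply: (induced_subgraph_sub addG GvUG).
  rewrite vertices_induced_add // vertices_induced fsubUset fsub1set !inE vG eqxx /=.
  apply: fsubset_trans (induced_subgraph_vertices HGU) _.
  by rewrite vertices_induced fsetIS // fsubsetUr.
apply: (induced_subgraph_sub H'GG addG).
rewrite vertices_induced_add //; apply/fsubsetP => x xH'.
have := fsubsetP H'sub x xH'; rewrite vertices_induced !inE.
case/andP=> _ /orP[-> //|xU]; rewrite (fsubsetP sub) ?orbT //.
by rewrite vertices_induced inE xH'.
Qed.

End MaximalSubgraphs.

(** * Cost and outcome of timed loops *)

Lemma time_bind (A B : Type) (m : timed A) (f : A -> timed B) :
  time (bind m f) = (time m + time (f (result m)))%N.
Proof. by []. Qed.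

Lemma time_for_each_le (A : eqType) (S : Type) (l : seq A) (st : S)
    (body : A -> S -> timed S) b :
    (forall a st', a \in l -> time (body a st') <= b) ->
  time (for_each l st body) <= size l * b.+1.
Proof.
elim: l st => //= a l IHl st bnd.
rewrite add1n mulSn addSn ltnS leq_add //; first by rewrite bnd // inE eqxx.
by apply: IHl => a' st' a'l; rewrite bnd // inE a'l orbT.
Qed.

(** This is the shape of the inner loop, with [p] the maximality test and [add] the insertion; the
    test does not look at the collection being built. *)
Lemma for_each_filter (K : choiceType) (l : seq K) (C : {fset K})
    (p : K -> timed bool) (add : K -> {fset K} -> timed {fset K}) x :
    (forall y D, result (add y D) = y |` D) ->
  (x \in result (for_each l C (fun y D =>
            bind (p y) (fun b => if b then add y D else ret D)))) =
  (x \in C) || (x \in l) && result (p x).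
Proof.
move=> addE; elim: l C => [|y l IHl] C /=; first by rewrite orbF.
rewrite IHl inE; case E: (result (p y)); rewrite /= ?addE ?inE.
  by have [->|] := eqVneq x y; rewrite /= ?E ?orbT.
by have [->|] := eqVneq x y; rewrite /= ?E ?andbF.
Qed.

(* An element that was added before its turn to be removed must be put back by
   its own round. *)
Lemma for_each_replace (K : choiceType) (l : seq K) (C : {fset K})
    (body : K -> {fset K} -> timed {fset K}) (new : K -> pred K) x :
    (forall y z D, (z \in result (body y D)) = (z \in D `\ y) || new y z) ->
    (forall y z, y \in l -> z \in l -> new y z -> new z z) ->
  (x \in result (for_each l C body)) =
  (x \in C) && (x \notin l) || has (new^~ x) l.
Proof.
move=> bodyE; elim: l C => [|y l IHl] C newP /=; first by rewrite andbT orbF.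
rewrite IHl => [|z t zl tl]; last by apply: newP; rewrite inE ?zl ?tl orbT.
rewrite bodyE !inE negb_or.
case new_yx: (new y x) => /=; rewrite ?orbT ?orbF ?(andbC (x != y)) ?andbA //=.
  case xl: (x \in l) => //=; apply/hasP; exists x => //=.
  by apply: (newP y); rewrite ?inE ?eqxx ?xl ?orbT.
by rewrite -andbA [(x != y) && _]andbC andbA.
Qed.

(** * Correctness of GenHered *)

Section GenHered.
Variables (T : choiceType) (P : graph T -> Prop).
Variables (M : graph T -> timed bool) (s : nat -> nat).
Variables (R : graph T -> timed (seq (graph T))) (r : nat -> nat -> nat).
Hypotheses (P_property : graph_property P) (P_hereditary : hereditary P).
Hypotheses (M_test : membership_test P M s) (R_proc : restricted_procedure P R r).
Implicit Types (G H : graph T) (us vs : seq T).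

Lemma no_extensionP G us H :
  result (no_extension M G us H) <->
  forall v, v \in us -> v \notin vertices H -> ~ P (induced_add G H v).
Proof.
elim: us => [|u us IHus] //=; case: ifPn => uH /=.
  rewrite IHus; split=> noext v; last by move=> vus; apply: noext; rewrite inE vus orbT.
  by rewrite inE => /predU1P[-> /negP//|]; apply: noext.
have test := test_correct M_test (induced_add G H u).
case: (result (M _)) test => [[/(_ isT) Pu _]|[_ nPu]] /=.
  by split=> // /(_ u); rewrite inE eqxx => /(_ isT uH).
rewrite IHus; split=> noext v; last by move=> vus; apply: noext; rewrite inE vus orbT.
by rewrite inE => /predU1P[-> _ /nPu//|]; apply: noext.
Qed.

(** For a hereditary property, one-vertex extensions decide maximality: if a [P]-subgraph [H']
    contains [H] and a further vertex [v], then [G[H, v]] is induced in [H'] and so is in [P]. *)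
Lemma maximality_testP n G us H :
    {subset us <= vertices G} -> induced_subgraph H (induced G [fset x in us]) ->
  result (maximality_test M n G us H) <->
  maximal_P_subgraph P (induced G [fset x in us]) H.
Proof.
move=> usG Hus; set Gus := induced G _ in Hus *.
have HG := induced_subgraph_trans Hus (induced_subgraph_induced _ _).
have test := test_correct M_test H; rewrite /maximality_test /=.
case: (result (M H)) test => [[/(_ isT) PH _]|[_ nPH]] /=; last first.
  by split=> // -[[_ /nPH]].
rewrite no_extensionP maximal_P_subgraphP; split=> [noext|[_ maxH] v vus vH Pv].
  split=> // H' [H'us PH'] sub.
  have H'G := induced_subgraph_trans H'us (induced_subgraph_induced _ _).
  apply: (induced_subgraph_inj H'us Hus); apply/eqP; rewrite eqEfsubset sub andbT.
  apply/fsubsetP => v vH'; apply: contraT => vH.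
  have := fsubsetP (induced_subgraph_vertices H'us) v vH'.
  rewrite vertices_induced !inE => /andP[vG vus].
  case: (noext v vus vH); apply: P_hereditary PH' _.
  apply: (induced_subgraph_sub (induced_add_subgraph _ _ _) H'G).
  by rewrite vertices_induced_add // fsubUset fsub1set vH'.
have vG := usG v vus.
have addG := induced_add_subgraph G H v.
(* An extension in [P] would be a [P]-subgraph above [H], hence [H] itself, although [v] is outside
   [H]. *)
have E : induced_add G H v = H.
  apply: maxH; last by rewrite vertices_induced_add // fsubsetUr.
  split=> //; apply: (induced_subgraph_sub addG (induced_subgraph_induced _ _)).
  rewrite vertices_induced_add // fsubUset fsub1set induced_subgraph_vertices //.
  by rewrite vertices_induced !inE vG vus.
by move: vH; rewrite -E vertices_induced_add // fset1U1.
Qed.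

Lemma fset_rcons us v : [fset x in rcons us v] = v |` [fset x in us].
Proof. by apply/fsetP => x; rewrite !inE mem_rcons inE. Qed.

Lemma result_gen_hered_step n G us v :
    {subset rcons us v <= vertices G} -> v \notin us ->
  result (gen_hered_step M R n G (rcons us v) v
            (max_P_subgraphs P (induced G [fset x in us]))) =
  max_P_subgraphs P (induced G [fset x in rcons us v]).
Proof.
move=> usG vus; set C := max_P_subgraphs P _; set Gv := induced G _.
have vG : v \in vertices G by apply: usG; rewrite mem_rcons inE eqxx.
have GvG : induced_subgraph Gv G by apply: induced_subgraph_induced.
have inC H : H \in C -> [/\ P_subgraph P G H, v \notin vertices H,
    induced_subgraph H Gv & induced_subgraph (induced_add G H v) Gv].
  move=> /in_max_P_subgraphs[[Hus PH] _].
  have HG := induced_subgraph_trans Hus (induced_subgraph_induced _ _).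
  have sub := induced_subgraph_vertices Hus.
  have subv : vertices H `<=` vertices Gv.
    apply: fsubset_trans sub _.
    by rewrite !vertices_induced fset_rcons fsetIS // fsubsetUr.
  split=> //.
  - by apply/negP => /(fsubsetP sub); rewrite vertices_induced !inE (negbTE vus) andbF.
  - exact: (induced_subgraph_sub HG GvG subv).
  - apply: (induced_subgraph_sub (induced_add_subgraph _ _ _) GvG).
    rewrite vertices_induced_add // fsubUset fsub1set subv andbT.
    by rewrite vertices_induced !inE vG mem_rcons inE eqxx.
(* [new H H'] says that the round of [H] adds [H']; by [newP], this means that [H'] is maximal both
   in [G[H, v]] and in [Gv]. *)
pose new H H' :=
  (H' \in result (R (induced_add G H v)))
  && result (maximality_test M n G (rcons us v) H').
have newP H H' : H \in C ->
    new H H' <-> maximal_P_subgraph P (induced_add G H v) H' /\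
                 maximal_P_subgraph P Gv H'.
  move=> /inC[PH vH HGv addGv].
  have almost := almost_satisfies_add PH vG vH.
  rewrite /new (proc_correct R_proc almost).
  split=> [/andP[/in_max_P_subgraphs maxH' test]|[maxH' maxH'v]].
    split=> //; apply/(maximality_testP n) => //.
    by case: maxH' => -[H'add _] _; apply: (induced_subgraph_trans H'add addGv).
  apply/andP; split; first exact/in_max_P_subgraphs.
  by apply/maximality_testP => //; case: maxH'v => -[].
apply/fsetP => H'; rewrite /gen_hered_step /=.
rewrite (@for_each_replace _ _ _ _ new); first last.
(* An old member [H2] that is still maximal in [Gv] is also maximal in [G[H2, v]], which lies
   between them, so its own round puts it back. *)
- move=> H1 H2 H1C H2C /(newP _ _ H1C)[_ maxH2]; apply/(newP _ _ H2C); split=> //.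
  have [[H2G _] _ _ addGv] := inC _ H2C.
  apply: (maximal_P_subgraph_sub addGv _ maxH2).
  exact: induced_subgraph_add.
- by move=> H1 H2 D /=; rewrite for_each_filter.
(* The copied list contains all of [C], so an old member survives only by being added again. *)
rewrite andbN /=; apply/hasP/idP => [[H HC /(newP _ _ HC)[_ maxH']]|].
  exact/in_max_P_subgraphs.
move=> /in_max_P_subgraphs maxH'.
have [||H maxH maxaddH] := @maximal_P_subgraph_step _ P P_hereditary
   G [fset x in us] v H' vG.
- by rewrite !inE.
- by rewrite -fset_rcons.
have HC : H \in C by apply/in_max_P_subgraphs.
by exists H => //; apply/(newP _ _ HC).
Qed.

Lemma result_gen_hered_loop n G us vs :
    uniq (us ++ vs) -> {subset us ++ vs <= vertices G} ->
  result (gen_hered_loop M R n G us vs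
            (max_P_subgraphs P (induced G [fset x in us]))) =
  max_P_subgraphs P (induced G [fset x in us ++ vs]).
Proof.
elim: vs us => [|v vs IHvs] us /=; first by rewrite cats0.
rewrite -cat_rcons => uniq_us sub.
rewrite result_gen_hered_step ?IHvs // => [x xus|].
  by rewrite sub // mem_cat xus.
by move: uniq_us; rewrite cat_uniq rcons_uniq => /andP[/andP[]].
Qed.

Lemma result_gen_hered G vs :
  vertex_enumeration G vs -> result (gen_hered M R G vs) = max_P_subgraphs P G.
Proof.
move=> [uniq_vs vsG]; rewrite /gen_hered /=.
have E0 : [fset x in [::]] = fset0 :> {fset T} by apply/fsetP => x; rewrite !inE.
rewrite -(max_P_subgraphs_induced0 P_property P_hereditary G) -E0.
rewrite result_gen_hered_loop //= => [|x]; last by rewrite vsG.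
by rewrite induced_all //; apply/fsubsetP => x xG; rewrite !inE vsG.
Qed.

(** * Running time of GenHered *)

Lemma time_M_le G H :
  induced_subgraph H G -> time (M H) <= s #|` vertices G|.
Proof.
move=> HG; apply: leq_trans (test_time M_test H) _.
by apply: test_mono M_test _ _ _; apply/fsubset_leq_card/induced_subgraph_vertices.
Qed.

(** The 3 is one loop tick plus setting and clearing a vector entry. *)
Lemma time_no_extension_le G us H :
  time (no_extension M G us H) <= size us * (s #|` vertices G| + 3).
Proof.
elim: us => //= u us IHus; have := time_M_le (induced_add_subgraph G H u).
by case: ifP => _ /=; [|case: ifP => _ /=]; lia.
Qed.

Lemma time_maximality_test_le n G us H :
    induced_subgraph H G ->
  time (maximality_test M n G us H) <=
  n.+1 + s #|` vertices G| + size us * (s #|` vertices G| + 3).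
Proof.
move=> HG; have := time_M_le HG; have := time_no_extension_le G us H.
by rewrite /maximality_test /=; case: ifP => _ /=; lia.
Qed.

Lemma time_R_le G H :
    induced_subgraph H G -> almost_satisfies P H ->
  time (R H) <= r #|` vertices G| #|` max_P_subgraphs P G|.
Proof.
move=> HG almost; apply: leq_trans (proc_time R_proc almost) _.
apply: proc_mono R_proc _ _ _ _ _ _; last exact: card_max_P_subgraphs_mono.
exact/fsubset_leq_card/induced_subgraph_vertices.
Qed.

(** The first [2 * n.+1] pays for removing [H] and building [G[H, v]], the second for the fixed part
    of the maximality test and the insertion. *)
Lemma time_gen_hered_step_le n K G us v :
    n = #|` vertices G| -> K = #|` max_P_subgraphs P G| -> size us < n ->
    {subset rcons us v <= vertices G} -> v \notin us ->
  time (gen_hered_step M R n G (rcons us v) v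
          (max_P_subgraphs P (induced G [fset x in us]))) <=
  n.+1 * K.+1 +
  K * (2 * n.+1 + r n K +
       r n K * (2 * n.+1 + s n + n * (s n + 3)).+1).+1.
Proof.
move=> nE KE us_n usG vus; set C := max_P_subgraphs P _.
have vG : v \in vertices G by apply: usG; rewrite mem_rcons inE eqxx.
have CK : #|` C| <= K.
  by rewrite KE; apply/card_max_P_subgraphs_mono/induced_subgraph_induced.
rewrite /gen_hered_step /= addn0.
apply: leq_add; first by rewrite leq_mul2l.
apply: leq_trans (time_for_each_le _ _) (leq_mul CK (leqnn _)) => H D.
move=> /in_max_P_subgraphs[[Hus PH] _] /=.
have HG := induced_subgraph_trans Hus (induced_subgraph_induced _ _).
have vH : v \notin vertices H.
  apply/negP => /(fsubsetP (induced_subgraph_vertices Hus)).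
  by rewrite vertices_induced !inE (negbTE vus) andbF.
have almost : almost_satisfies P (induced_add G H v).
  by apply: almost_satisfies_add.
have addG := induced_add_subgraph G H v.
have tR := time_R_le addG almost; rewrite -KE -nE in tR.
(* The number of candidates is bounded by the time needed to output them; this is why [r] multiplies
   the cost of a test. *)
have sR := leq_trans (proc_output R_proc almost) tR.
set B := (2 * n.+1 + s n + n * (s n + 3))%N.
have inner : time (for_each (result (R (induced_add G H v))) (D `\ H)
    (fun H' C3 => bind (maximality_test M n G (rcons us v) H')
       (fun b => if b then coll_add n H' C3 else ret C3))) <= r n K * B.+1.
  apply: leq_trans (time_for_each_le _ _) (leq_mul sR (leqnn _)) => H' D'.
  rewrite (proc_correct R_proc almost) => /in_max_P_subgraphs[[H'add _] _].
  have := time_maximality_test_le n (rcons us v) (induced_subgraph_trans H'add addG).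
  have : (size us).+1 * (s n + 3) <= n * (s n + 3) by rewrite leq_mul2r us_n orbT.
  rewrite -nE size_rcons /B; case: (maximality_test _ _ _ _ _) => b t /=.
  by case: b => /=; lia.
by rewrite addn0 mul2n -addnn -!addnA !leq_add2l leq_add.
Qed.

Lemma time_gen_hered_loop_le n K G us vs :
    n = #|` vertices G| -> K = #|` max_P_subgraphs P G| -> size (us ++ vs) <= n ->
    uniq (us ++ vs) -> {subset us ++ vs <= vertices G} ->
  time (gen_hered_loop M R n G us vs
          (max_P_subgraphs P (induced G [fset x in us]))) <=
  size vs * (n.+1 * K.+1 +
    K * (2 * n.+1 + r n K +
         r n K * (2 * n.+1 + s n + n * (s n + 3)).+1).+1).+1.
Proof.
move=> nE KE; have := fun us v => @time_gen_hered_step_le n K G us v nE KE.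
set B := (n.+1 * K.+1 + _)%N; move: B => B step.
elim: vs us => [|v vs IHvs] us //; rewrite -cat_rcons => size_us uniq_us sub.
have sub_us : {subset rcons us v <= vertices G}.
  by move=> x xus; rewrite sub // mem_cat xus.
have vus : v \notin us.
  by move: uniq_us; rewrite cat_uniq rcons_uniq => /andP[/andP[]].
have us_n : size us < n.
  by apply: leq_trans size_us; rewrite size_cat size_rcons leq_addr.
rewrite [size _]/= mulSn addSn /gen_hered_loop -/gen_hered_loop time_bind add1n ltnS.
by rewrite time_bind result_gen_hered_step // leq_add ?step ?IHvs.
Qed.

Lemma time_gen_hered_le G vs :
    vertex_enumeration G vs ->
  let n := size vs in
  let K := #|` max_P_subgraphs P G| in
  0 < n -> time (gen_hered M R G vs) <= 40 * (n ^ 2 * s n * K * r n K).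
Proof.
move=> [uniq_vs vsG] n K n_gt0.
have nE : n = #|` vertices G|.
  by apply/perm_size/uniq_perm; rewrite ?fset_uniq.
have K_gt0 : 0 < K by apply: card_max_P_subgraphs_gt0.
have s_gt0 : 0 < s n.
  by rewrite nE; apply: leq_trans (test_pos M_test G) (test_time M_test G).
(* Since [n] is positive there is a vertex [v]; on the one-vertex graph [G[O_0, v]], [R] outputs at
   least one graph and so takes at least one step. *)
have r_gt0 : 0 < r n K.
  have /hasP[v vvs _] : has predT vs by rewrite has_predT.
  have vG : v \in vertices G by rewrite -vsG.
  have almost : almost_satisfies P (induced_add G (graph0 T) v).
    apply: almost_satisfies_add => //.
    by split; [apply: graph0_subgraph | apply: graph0_in_property].
  rewrite nE; apply: leq_trans (time_R_le (induced_add_subgraph _ _ _) almost).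
  apply: leq_trans (proc_output R_proc almost).
  have := card_max_P_subgraphs_gt0 P_property P_hereditary (induced_add G (graph0 T) v).
  rewrite cardfs_gt0 => /fset0Pn[H]; rewrite -(proc_correct R_proc almost).
  by case: (result _).
have E0 : [fset x in [::]] = fset0 :> {fset T} by apply/fsetP => x; rewrite !inE.
rewrite /gen_hered -(max_P_subgraphs_induced0 P_property P_hereditary G) -E0 /=.
have := @time_gen_hered_loop_le n K G [::] vs nE erefl (leqnn _) uniq_vs.
have sub : {subset vs <= vertices G} by move=> x; rewrite vsG.
move=> /(_ sub) loop.
apply: leq_trans (leq_add (leqnn 1) loop) _.
exact: gen_hered_cost_le.
Qed.

End GenHered.

Theorem theorem5p1 (T : choiceType) (P : graph T -> Prop)
    (M : graph T -> timed bool) (s : nat -> nat)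
    (R : graph T -> timed (seq (graph T))) (r : nat -> nat -> nat)
    (P_property : graph_property P) (P_hereditary : hereditary P)
    (M_test : membership_test P M s) (s_poly : polynomially_bounded s)
    (R_proc : restricted_procedure P R r) :
  (forall (G : graph T) (vs : seq T), vertex_enumeration G vs ->
     result (gen_hered M R G vs) = max_P_subgraphs P G)
  /\
  exists C : nat, forall (G : graph T) (vs : seq T), vertex_enumeration G vs ->
    let n := size vs in
    let K := #|` max_P_subgraphs P G| in
    0 < n ->
    time (gen_hered M R G vs) <= C * (n ^ 2 * s n * K * r n K).
Proof.
split=> [G vs|]; first exact: (result_gen_hered P_property P_hereditary M_test R_proc).
exists 40 => G vs; exact: (time_gen_hered_le P_property P_hereditary M_test R_proc).
Qed.
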